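(* Let $q>0$, $q\neq 1$ and $0<c<1$ be fixed. Let $r\ge m\ge n\ge s$ be positive integers satisfying $r+s=m+n$. (i) If $s=1$ and $0<q<1$, then $x\mapsto F_{r,m,n,1}(x;q,c)$ is completely monotonic on $(0,\infty)$. (ii) If $s=2$, then $x\mapsto F_{r,m,n,2}(x;q,c)$ is completely monotonic on $(0,\infty)$ (for all $q>0$, $q\ne 1$). (iii) If $s=3$ and $n=4$, then $x\mapsto F_{r,m,4,3}(x;q,c)$ is completely monotonic on $(0,\infty)$ (for all $q>0$, $q\neq 1$).
   Context: A function $f$ is completely monotonic on an interval $(a,b)$ if it has derivatives of all orders there and $(-1)^k f^{(k)}(x)\ge 0$ for all $x\in(a,b)$ and all integers $k\ge 0$. For $x>0$ and $q>0$, $q\ne 1$, the $q$-gamma function is $$\Gamma_q(x)=(1-q)^{1-x}\prod_{n=0}^{\infty}\frac{1-q^{n+1}}{1-q^{n+x}}\quad (0<q<1),$$ $$\Gamma_q(x)=(q-1)^{1-x}q^{\frac12 x(x-1)}\prod_{n=0}^{\infty}\frac{1-q^{-(n+1)}}{1-q^{-(n+x)}}\quad (q>1).$$ Let $\psi_q(x)=\frac{d}{dx}\ln\Gamma_q(x)$ be its logarithmic derivative, and let $\psi_q^{(k)}$ ($k\ge 1$) be its $k$-th derivative; set $\psi_q^{(0)}=\psi_q$. For a function $f$ and real $c\ne 0$ write $\Delta f(x;c)=\dfrac{f(x+c)-f(x)}{c}$. For positive integers $r,m,n,s$ let $\alpha_{r,m,n,s}=\dfrac{(m-1)!(n-1)!}{(r-1)!(s-1)!}$.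 For positive integers $r\ge m\ge n\ge s$ define $$F_{r,m,n,s}(x;q,c)=(-1)^{m+n}\Delta\psi_q^{(m-1)}(x;c)\,\Delta\psi_q^{(n-1)}(x;c)-\alpha_{r,m,n,s}(-1)^{r+s}\Delta\psi_q^{(r-1)}(x;c)\,\Delta\psi_q^{(s-1)}(x;c).$$ *)

(* Defs.v *)
From Stdlib Require Import Reals Factorial.
From Coquelicot Require Import Coquelicot.
Open Scope R_scope.

Definition completely_monotonic (f : R -> R) (a b : Rbar) : Prop :=
  forall (k : nat) (x : R), Rbar_lt a x -> Rbar_lt x b ->
    ex_derive_n f k x /\ 0 <= (-1) ^ k * Derive_n f k x.

Definition infinite_product (u : nat -> R) : R :=
  real (Lim_seq (fun N : nat => prod_f_R0 u N)).

(* Only meaningful for x > 0 and q > 0, q <> 1. *)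
Definition qGamma (q x : R) : R :=
  if Rlt_dec q 1 then
    Rpower (1 - q) (1 - x) *
    infinite_product (fun n =>
      (1 - Rpower q (INR n + 1)) / (1 - Rpower q (INR n + x)))
  else
    Rpower (q - 1) (1 - x) * Rpower q (1 / 2 * x * (x - 1)) *
    infinite_product (fun n =>
      (1 - Rpower q (- (INR n + 1))) / (1 - Rpower q (- (INR n + x)))).

Definition qpsi (q x : R) : R := Derive (fun t => ln (qGamma q t)) x.

Definition qpolygamma (q : R) (k : nat) (x : R) : R := Derive_n (qpsi q) k x.

Definition Delta (f : R -> R) (x c : R) : R := (f (x + c) - f x) / c.

Definition alpha (r m n s : nat) : R :=
  (INR (fact (m - 1)) * INR (fact (n - 1))) /
  (INR (fact (r - 1)) * INR (fact (s - 1))).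

Definition F (r m n s : nat) (x q c : R) : R :=
  (-1) ^ (m + n) *
    Delta (qpolygamma q (m - 1)) x c * Delta (qpolygamma q (n - 1)) x c
  - alpha r m n s * (-1) ^ (r + s) *
    Delta (qpolygamma q (r - 1)) x c * Delta (qpolygamma q (s - 1)) x c.

(* Main.v *)
Require Import Defs.
From Stdlib Require Import Reals Factorial Lra Lia.
From Coquelicot Require Import Coquelicot.
Open Scope R_scope.

(** With [p = min(q, 1/q)], [psi_q(x)] is an affine function of [x] plus
    [ln p * sum_k p^(kx) / (1 - p^k)]; the affine part is constant when [q < 1] and in
    general only contributes to the difference quotient of [psi_q] itself.  Hence
    [Delta psi_q^(j)] is a multiple of [sum_k k^j w_k p^(kx)] with
    [w_k = (1 - p^(ck)) / (1 - p^k)], and [F] is a nonnegative multiple of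
    [sum_N A_N p^(Nx)], where [A_N = sum_(i+j=N) w_i w_j d(i,j)] and
    [d(i,j) = i^(m-1) j^(n-1) / ((m-1)! (n-1)!) - i^(r-1) j^(s-1) / ((r-1)! (s-1)!)].
    It suffices that [A_N >= 0].  The sequence [w] is log-concave because [c < 1], so
    [w_i w_(N-i)] increases towards the middle, while the symmetrization of [d] changes
    sign once, from negative to positive, on the way to the middle.  This reduces the
    claim to [w = 1], an inequality between sums of powers, which is proved by taking
    finite differences in [N]. *)

(** * Convolutions of powers *)

Lemma sum_f_R0_rev (f : nat -> R) (N : nat) :
  sum_f_R0 (fun j => f (N - j)%nat) N = sum_f_R0 f N.
Proof.
  revert f; induction N as [|N IH]; intros f; [reflexivity|].
  rewrite tech5, Nat.sub_diag, (decomp_sum f (S N)) by lia.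
  simpl Nat.pred. rewrite <- (IH (fun i => f (S i))), Rplus_comm.
  f_equal. apply sum_eq; intros i hi; f_equal; lia.
Qed.

Definition conv (f g : nat -> R) (N : nat) : R :=
  sum_f_R0 (fun j => f j * g (N - j)%nat) N.

Lemma conv_comm (f g : nat -> R) (N : nat) : conv f g N = conv g f N.
Proof.
  unfold conv. rewrite <- (sum_f_R0_rev (fun j => g j * f (N - j)%nat)).
  apply sum_eq; intros i hi. replace (N - (N - i))%nat with i by lia. ring.
Qed.

(* Zero at [j = 0] even when [k = 0], so that convolutions run over positive indices. *)
Definition divpow (k j : nat) : R :=
  match j with O => 0 | _ => INR j ^ k / INR (fact k) end.

Lemma divpow_pos (k j : nat) : divpow k (S j) = INR (S j) ^ k / INR (fact k).
Proof. reflexivity. Qed.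

Lemma divpow_1 (k : nat) : divpow k 1 = / INR (fact k).
Proof. rewrite divpow_pos. simpl INR. rewrite pow1. unfold Rdiv; ring. Qed.

Lemma divpow_pow (k j : nat) : (1 <= k)%nat -> divpow k j = INR j ^ k / INR (fact k).
Proof.
  intros hk; destruct j as [|j]; [|reflexivity].
  simpl INR. rewrite pow_i by lia. unfold divpow, Rdiv; ring.
Qed.

Lemma divpow_ge0 (k j : nat) : 0 <= divpow k j.
Proof.
  destruct j as [|j]; [simpl; lra|]. rewrite divpow_pos.
  apply Rmult_le_pos; [apply pow_le, pos_INR|].
  left; apply Rinv_0_lt_compat, INR_fact_lt_0.
Qed.

Lemma divpow_S_pos (k N : nat) :
  divpow k (S (S N)) = sum_f_R0 (fun i => divpow i (S N) / INR (fact (k - i))) k.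
Proof.
  rewrite divpow_pos, (S_INR (S N)), binomial. unfold Rdiv at 1.
  rewrite Rmult_comm, scal_sum. apply sum_eq; intros i hi.
  rewrite divpow_pos, pow1. unfold Binomial.C.
  field; repeat split; apply INR_fact_neq_0.
Qed.

(** The convention [divpow i 0 = 0] empties the binomial sum at [N = 0]; the last term restores the
    value [1 / k!] there. *)
Lemma divpow_S (k N : nat) :
  divpow k (S N) = sum_f_R0 (fun i => divpow i N / INR (fact (k - i))) k
    + (if N then / INR (fact k) else 0).
Proof.
  destruct N as [|N].
  - rewrite divpow_1, (sum_eq _ (fun _ => 0)), sum_cte; [ring|].
    intros; simpl; unfold Rdiv; ring.
  - rewrite divpow_S_pos; ring.
Qed.

Definition cpow (p k N : nat) : R := conv (divpow p) (divpow k) N.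

Lemma sum_f_R0_exchange (f : nat -> nat -> R) (M N : nat) :
  sum_f_R0 (fun i => sum_f_R0 (fun j => f i j) N) M
  = sum_f_R0 (fun j => sum_f_R0 (fun i => f i j) M) N.
Proof.
  induction M as [|M IH]; [reflexivity|].
  simpl sum_f_R0 at 1. rewrite IH, <- sum_plus. reflexivity.
Qed.

Lemma cpow_0 (p k : nat) : cpow p k 0 = 0.
Proof. unfold cpow, conv; simpl; ring. Qed.

(** Expand the second factor at [S N - j = (N - j) + 1]. The term outside the sum comes from
    [j = N], where [N - j = 0]. This recurrence in [N] drives every comparison of convolutions
    below. *)
Lemma cpow_S (p k N : nat) :
  cpow p k (S N) = sum_f_R0 (fun i => cpow p i N / INR (fact (k - i))) k
    + divpow p N / INR (fact k).
Proof.
  unfold cpow at 1, conv. rewrite tech5, Nat.sub_diag.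
  replace (divpow k 0) with 0 by reflexivity. rewrite Rmult_0_r, Rplus_0_r.
  transitivity (sum_f_R0 (fun j => sum_f_R0 (fun i =>
      divpow p j * divpow i (N - j) / INR (fact (k - i))) k) N
    + sum_f_R0 (fun j => if (N - j)%nat then divpow p j / INR (fact k) else 0) N).
  - rewrite <- sum_plus. apply sum_eq; intros j hj.
    replace (S N - j)%nat with (S (N - j)) by lia.
    rewrite divpow_S, Rmult_plus_distr_l, scal_sum. f_equal.
    + apply sum_eq; intros; unfold Rdiv; ring.
    + destruct (N - j)%nat; unfold Rdiv; ring.
  - rewrite <- sum_f_R0_exchange. f_equal.
    + apply sum_eq; intros i hi. unfold cpow, conv, Rdiv.
      rewrite (Rmult_comm (sum_f_R0 _ _)), scal_sum. reflexivity.
    + destruct N as [|N]; [reflexivity|].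
      rewrite tech5, Nat.sub_diag, (sum_eq _ (fun _ => 0)), sum_cte; [ring|].
      intros i hi. destruct (S N - i)%nat eqn:E; [lia|reflexivity].
Qed.

Lemma cpow_comm (p k N : nat) : cpow p k N = cpow k p N.
Proof. apply conv_comm. Qed.

Lemma cpow_k0_S (p N : nat) : cpow p 0 (S N) = cpow p 0 N + divpow p N.
Proof. rewrite cpow_S; simpl; field. Qed.

Lemma cpow_k1_S (p N : nat) : cpow p 1 (S N) = cpow p 1 N + cpow p 0 (S N).
Proof. rewrite cpow_k0_S, cpow_S; simpl; field. Qed.

(* The binomial expansion of (N+1)^(p+k), whose low-order terms are dominated
   by those of theta ((N+1)^p - N^p). *)
Lemma divpow_increment (p k : nat) (theta : R) :
  (forall a, (a <= p)%nat -> (1 <= a)%nat \/ a = p ->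
     / INR (fact (a + k)) <= theta / INR (fact a)) ->
  forall N, divpow (p + k) (S N) <=
    sum_f_R0 (fun i => divpow (p + i) N / INR (fact (k - i))) k
    + theta * (divpow p (S N) - divpow p N).
Proof.
  intros hth N. destruct N as [|N].
  - rewrite !divpow_1, (sum_eq _ (fun _ => 0)), sum_cte.
    + specialize (hth p ltac:(lia) ltac:(lia)). simpl divpow.
      unfold Rdiv in hth. lra.
    + intros; simpl; unfold Rdiv; ring.
  - rewrite (divpow_S_pos (p + k)). destruct p as [|p].
    + rewrite Nat.add_0_l, !(divpow_pos 0), !pow_O. apply Req_le.
      rewrite Rminus_diag, Rmult_0_r, Rplus_0_r. reflexivity.
    + rewrite (divpow_S_pos (S p)), (tech2 _ p (S p + k)) by lia.
      rewrite (tech5 _ p), Nat.sub_diag.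
      replace (S p + k - S p)%nat with k by lia.
      rewrite (sum_eq (fun i => divpow (S p + i) (S N) / INR (fact (S p + k - (S p + i))))
        (fun i => divpow (S p + i) (S N) / INR (fact (k - i))))
        by (intros; replace (S p + k - (S p + i))%nat with (k - i)%nat by lia; reflexivity).
      rewrite Rplus_comm. apply Rplus_le_compat_l.
      change (INR (fact 0)) with 1. rewrite Rdiv_1_r.
      match goal with |- _ <= theta * (?a + ?b - ?b) => replace (a + b - b) with a by ring end.
      rewrite scal_sum. apply sum_Rle; intros l hl.
      (* The term of degree [l <= p] carries [1 / (a + k)!] on the left and [theta / a!] on the
         right, with [a = S p - l >= 1]. The case [a = p] of the hypothesis serves [N = 0]. *)
      specialize (hth (S p - l)%nat ltac:(lia) ltac:(lia)).
      replace (S p - l + k)%nat with (S p + k - l)%nat in hth by lia.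
      apply (Rmult_le_compat_l (divpow l (S N))) in hth; [|apply divpow_ge0].
      unfold Rdiv in *. lra.
Qed.

(** [divpow_increment] summed over [N]. The result mimics the recurrence [cpow_S] of [cpow p k],
    with [cpow (p + i) 0] in place of [cpow p i], so the two can be compared by induction on [N]. *)
Lemma cpow_sum_ge (p k : nat) (theta : R) :
  (forall a, (a <= p)%nat -> (1 <= a)%nat \/ a = p ->
     / INR (fact (a + k)) <= theta / INR (fact a)) ->
  forall N, cpow (p + k) 0 (S N) <=
    sum_f_R0 (fun i => cpow (p + i) 0 N / INR (fact (k - i))) k + theta * divpow p N.
Proof.
  intros hth N. induction N as [|N IH].
  - rewrite cpow_k0_S, cpow_0, (sum_eq _ (fun _ => 0)), sum_cte.
    + simpl divpow. lra.
    + intros; rewrite cpow_0; unfold Rdiv; ring.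
  - rewrite cpow_k0_S.
    rewrite (sum_eq (fun i => cpow (p + i) 0 (S N) / INR (fact (k - i)))
      (fun i => cpow (p + i) 0 N / INR (fact (k - i)) + divpow (p + i) N / INR (fact (k - i))))
      by (intros; rewrite cpow_k0_S; unfold Rdiv; ring).
    rewrite sum_plus. pose proof (divpow_increment p k theta hth N). lra.
Qed.

Lemma fact_mult_le (a k : nat) : (fact a * fact k <= fact (a + k))%nat.
Proof.
  induction a as [|a IH]; simpl; [lia|]. nia.
Qed.

Lemma fact_mult_S_le (a k : nat) : (fact (S a) * fact (S k) <= fact (S a + k))%nat.
Proof.
  induction a as [|a IH]; [simpl; lia|].
  replace (S (S a) + k)%nat with (S (S a + k)) by lia.
  change (fact (S (S a))) with (S (S a) * fact (S a))%nat.
  change (fact (S (S a + k))) with (S (S a + k) * fact (S a + k))%nat. nia.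
Qed.

Lemma inv_fact_le (a k b : nat) : (fact a * fact b <= fact k)%nat ->
  / INR (fact k) <= / INR (fact b) / INR (fact a).
Proof.
  intros h. apply le_INR in h. rewrite mult_INR in h.
  unfold Rdiv. rewrite <- Rinv_mult, (Rmult_comm (INR (fact b))).
  apply Rinv_le_contravar; [apply Rmult_lt_0_compat; apply INR_fact_lt_0|]. lra.
Qed.

(** The choice [theta = 1 / k!], admissible because [a! k! <= (a + k)!], is exactly the boundary
    coefficient in [cpow_S]. The induction on [N] keeps [k] general, since the recurrence involves
    all exponents [i <= k]. *)
Lemma cpow_ge_k0 (N p k : nat) : cpow (p + k) 0 N <= cpow p k N.
Proof.
  revert p k; induction N as [|N IH]; intros p k; [rewrite !cpow_0; lra|].
  rewrite (cpow_S p k).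
  eapply Rle_trans; [apply (cpow_sum_ge p k (/ INR (fact k)))|].
  - intros a _ _. apply inv_fact_le, fact_mult_le.
  - apply Rplus_le_compat; [|apply Req_le; unfold Rdiv; ring].
    apply sum_Rle; intros i hi. apply Rmult_le_compat_r; [|apply IH].
    left; apply Rinv_0_lt_compat, INR_fact_lt_0.
Qed.

(** One more summation of [cpow_sum_ge] over [N]. Since [p >= 1], only [a >= 1] occurs, and there
    the smaller constant [1 / (k + 1)!] is admissible. *)
Lemma cpow_k1_sum_ge (p k N : nat) : (1 <= p)%nat ->
  cpow (p + k) 1 (S N) <=
    sum_f_R0 (fun i => cpow (p + i) 1 N / INR (fact (k - i))) k
    + / INR (fact (S k)) * cpow p 0 (S N).
Proof.
  intros hp. induction N as [|N IH].
  - rewrite cpow_k1_S, !cpow_k0_S, !cpow_0, (sum_eq _ (fun _ => 0)), sum_cte.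
    + simpl divpow. lra.
    + intros; rewrite cpow_0; unfold Rdiv; ring.
  - rewrite cpow_k1_S, (cpow_k0_S p (S N)).
    rewrite (sum_eq (fun i => cpow (p + i) 1 (S N) / INR (fact (k - i)))
      (fun i => cpow (p + i) 1 N / INR (fact (k - i)) + cpow (p + i) 0 (S N) / INR (fact (k - i))))
      by (intros; rewrite cpow_k1_S; unfold Rdiv; ring).
    rewrite sum_plus.
    enough (cpow (p + k) 0 (S (S N)) <=
      sum_f_R0 (fun i => cpow (p + i) 0 (S N) / INR (fact (k - i))) k
      + / INR (fact (S k)) * divpow p (S N)) by lra.
    apply cpow_sum_ge. intros a _ ha. apply inv_fact_le.
    destruct a as [|a]; [lia|]. apply fact_mult_S_le.
Qed.

Lemma cpow_ge_k1 (N p k : nat) : (1 <= p)%nat -> cpow (p + k) 1 N <= cpow p (S k) N.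
Proof.
  revert k; induction N as [|N IH]; intros k hp; [rewrite !cpow_0; lra|].
  rewrite (cpow_S p (S k)), decomp_sum by lia.
  simpl Nat.pred. rewrite Nat.sub_0_r.
  eapply Rle_trans; [apply (cpow_k1_sum_ge p k N hp)|].
  (* In the recurrence for [cpow p (S k)], the term [i = 0] and the boundary term together give
     [cpow p 0 (S N) / (k + 1)!], which is the last term of the bound. *)
  rewrite cpow_k0_S.
  enough (sum_f_R0 (fun i => cpow (p + i) 1 N / INR (fact (k - i))) k <=
    sum_f_R0 (fun i => cpow p (S i) N / INR (fact (S k - S i))) k)
    by (unfold Rdiv in *; lra).
  apply sum_Rle; intros i hi. rewrite Nat.sub_succ.
  apply Rmult_le_compat_r; [|apply IH, hp].
  left; apply Rinv_0_lt_compat, INR_fact_lt_0.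
Qed.

(** The last inequality is Simpson's, rearranged; the others make the induction close. Passing from
    [p] to [p + 1] turns [a], [b] into [y a + b], [y b + a], and each of the four quantities becomes
    [y] times itself plus a nonnegative quantity: [a] for the first, [(p + 1) b] for the second, and
    the preceding quantity for the last two. *)
Lemma simpson_pow_aux (y : R) (p : nat) : 1 <= y ->
  let a := (y + 1) ^ p + (y - 1) ^ p in
  let b := (y + 1) ^ p - (y - 1) ^ p in
  0 <= b /\ 0 <= INR p * a - y * b
  /\ 0 <= (INR p - 1) * b - 2 * y * a + 4 * y ^ S p
  /\ 0 <= (INR p - 2) * a + 4 * (INR p + 1) * y ^ p - 3 * y * b.
Proof.
  intros hy a b; subst a b. induction p as [|p IH].
  - simpl; repeat split; lra.
  - cbv zeta in IH. rewrite S_INR.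
    change ((y + 1) ^ S p) with ((y + 1) * (y + 1) ^ p).
    change ((y - 1) ^ S p) with ((y - 1) * (y - 1) ^ p).
    change (y ^ S (S p)) with (y * (y * y ^ p)). change (y ^ S p) with (y * y ^ p) in *.
    assert (hA := pow_le (y + 1) p ltac:(lra)).
    assert (hB := pow_le (y - 1) p ltac:(lra)).
    assert (hP := pos_INR p).
    set (A := (y + 1) ^ p) in *. set (B := (y - 1) ^ p) in *. set (Y := y ^ p) in *.
    set (P := INR p) in *. destruct IH as (h1 & h2 & h3 & h4).
    assert (k1 := Rmult_le_pos y _ ltac:(lra) h1).
    assert (k2 := Rmult_le_pos y _ ltac:(lra) h2).
    assert (k3 := Rmult_le_pos y _ ltac:(lra) h3).
    assert (k4 := Rmult_le_pos y _ ltac:(lra) h4).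
    assert (k5 := Rmult_le_pos P _ hP h1).
    repeat split; lra.
Qed.

(* Simpson's rule overestimates the integral of t^p over [y-1, y+1]. *)
Lemma simpson_pow (y : R) (p : nat) : 1 <= y ->
  3 * ((y + 1) ^ S p - (y - 1) ^ S p)
  <= INR (S p) * ((y + 1) ^ p + 4 * y ^ p + (y - 1) ^ p).
Proof.
  intros hy. destruct (simpson_pow_aux y p hy) as (_ & _ & _ & h).
  rewrite S_INR. simpl pow. lra.
Qed.

Lemma divpow_simpson (p N : nat) : (1 <= p)%nat ->
  (divpow (S p) (S (S N)) - divpow (S p) N) / 2
  <= divpow p (S N) + (divpow p (S (S N)) - 2 * divpow p (S N) + divpow p N) / 6.
Proof.
  intros hp. rewrite !divpow_pow by lia.
  assert (h := simpson_pow (INR (S N)) p).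
  rewrite !(S_INR (S N)).
  replace (INR (S N) - 1) with (INR N) in h by (rewrite S_INR; ring).
  specialize (h ltac:(rewrite S_INR; pose proof (pos_INR N); lra)).
  change (fact (S p)) with (S p * fact p)%nat. rewrite mult_INR.
  assert (h1 : 0 < / INR (fact p)) by apply Rinv_0_lt_compat, INR_fact_lt_0.
  assert (h2 : 0 < / INR (S p)) by apply Rinv_0_lt_compat, lt_0_INR, Nat.lt_0_succ.
  assert (h3 := Rmult_lt_0_compat _ _ h1 h2).
  apply (Rmult_le_compat_l _ _ _ (Rlt_le _ _ h3)) in h.
  assert (E : / INR (S p) * INR (S p) = 1)
    by (apply Rinv_l, not_0_INR; lia).
  unfold Rdiv. rewrite Rinv_mult.
  rewrite <- (Rmult_assoc _ (INR (S p))) in h.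
  rewrite (Rmult_assoc _ (/ INR (S p)) (INR (S p))), E in h. lra.
Qed.

(** Repeated differencing in [N]: the claim has difference [d1], the difference of [d1] at [N] is
    [d2] at [S N], that of [d2] is [d3], and that of [d3] is [divpow_simpson]. Each level is
    recovered by induction from the next. *)
Lemma cpow_3_ge_2 (N p : nat) : (2 <= p)%nat -> cpow (S p) 2 N <= cpow p 3 N.
Proof.
  intros hp.
  assert (e0 : forall k, divpow k 0 = 0) by reflexivity.
  assert (d3 : forall N, (divpow (S p) N + divpow (S p) (S N)) / 2
    <= cpow p 0 (S N) + (divpow p (S N) - divpow p N) / 6).
  { clear N; intros N; induction N as [|N IH].
    - rewrite cpow_k0_S, cpow_0, !e0, !divpow_1.
      change (fact (S p)) with (S p * fact p)%nat. rewrite mult_INR, Rinv_mult.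
      assert (h1 : 0 < / INR (fact p)) by apply Rinv_0_lt_compat, INR_fact_lt_0.
      (* The base case of [d3] reads [1 / (2 (p+1)!) <= 1 / (6 p!)], that is [p + 1 >= 3]; this is
         where [p >= 2] enters. *)
      assert (h2 : / INR (S p) <= / 3).
      { apply Rinv_le_contravar; [lra|]. replace 3 with (INR 3) by (simpl; ring).
        apply le_INR; lia. }
      nra.
    - rewrite cpow_k0_S. pose proof (divpow_simpson p N ltac:(lia)). lra. }
  assert (d2 : forall N, cpow (S p) 0 N + divpow (S p) N / 2
    <= cpow p 1 N + divpow p N / 6).
  { clear N; intros N; induction N as [|N IH]; [rewrite !cpow_0, !e0; lra|].
    rewrite cpow_k1_S, (cpow_k0_S (S p)). specialize (d3 N). lra. }
  assert (s2 : forall q N, cpow q 2 (S N) = cpow q 2 N + cpow q 1 N + cpow q 0 (S N) / 2).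
  { intros q M. rewrite cpow_k0_S, cpow_S. simpl. field. }
  assert (d1 : forall N, cpow (S p) 1 N + cpow (S p) 0 (S N) / 2
    <= cpow p 2 N + cpow p 1 N / 2 + cpow p 0 (S N) / 6).
  { clear N; intros N; induction N as [|N IH].
    - rewrite !cpow_k0_S, !cpow_0, !e0; lra.
    - rewrite s2, !cpow_k1_S, (cpow_k0_S (S p) (S N)), (cpow_k0_S p (S N)).
      specialize (d2 (S N)). rewrite cpow_k1_S in d2. lra. }
  induction N as [|N IH]; [rewrite !cpow_0; lra|].
  rewrite s2. specialize (d1 N).
  assert (s3 : cpow p 3 (S N) = cpow p 3 N + cpow p 2 N + cpow p 1 N / 2 + cpow p 0 (S N) / 6).
  { rewrite cpow_k0_S, cpow_S. simpl. field. }
  lra.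
Qed.

(** * Weighted convolutions *)

Lemma geometric_sum_SS (x : R) (i : nat) :
  sum_f_R0 (pow x) (S (S i)) = 1 + x * sum_f_R0 (pow x) i + x ^ S (S i).
Proof.
  rewrite tech5, decomp_sum by lia. simpl Nat.pred. rewrite scal_sum.
  f_equal; f_equal. apply sum_eq; intros; simpl; ring.
Qed.

(* [sum_(l<=i) x^(l - i/2)] is a sum of terms [x^t + x^-t], hence decreasing in x < 1. *)
Lemma geometric_sum_normalized_decr (y p : R) (i : nat) : 0 < p -> p <= y -> y < 1 ->
  p ^ i * sum_f_R0 (pow (y * y)) i <= y ^ i * sum_f_R0 (pow (p * p)) i.
Proof.
  intros hp hpy hy.
  assert (main : p ^ i * sum_f_R0 (pow (y * y)) i <= y ^ i * sum_f_R0 (pow (p * p)) i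
    /\ p ^ S i * sum_f_R0 (pow (y * y)) (S i) <= y ^ S i * sum_f_R0 (pow (p * p)) (S i));
    [|apply main].
  induction i as [|i [IH1 IH2]].
  - simpl; split; [lra|].
    assert (0 <= (y - p) * (1 - y * p)) by (apply Rmult_le_pos; nra). lra.
  - split; [exact IH2|]. rewrite !geometric_sum_SS, !Rpow_mult_distr.
    assert (hu : p ^ S (S i) <= y ^ S (S i)) by (apply pow_incr; lra).
    assert (hu1 : y ^ S (S i) <= 1)
      by (rewrite <- (pow1 (S (S i))); apply pow_incr; lra).
    assert (hu0 : 0 < p ^ S (S i)) by (apply pow_lt; lra).
    set (u := y ^ S (S i)) in *. set (v := p ^ S (S i)) in *.
    assert (h : 0 <= (u - v) * (1 - u * v)) by (apply Rmult_le_pos; nra).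
    assert (h2 : 0 <= p * p * (y * y)) by nra.
    apply (Rmult_le_compat_l _ _ _ h2) in IH1.
    assert (Eu : u = y * y * y ^ i) by (unfold u; simpl; ring).
    assert (Ev : v = p * p * p ^ i) by (unfold v; simpl; ring).
    apply Rle_trans with (v + v * u * u + p * p * (y * y) * (p ^ i * sum_f_R0 (pow (y * y)) i));
      [apply Req_le; rewrite Ev at 2; rewrite Ev; ring|].
    apply Rle_trans with (u + u * v * v + p * p * (y * y) * (y ^ i * sum_f_R0 (pow (p * p)) i));
      [lra|apply Req_le; rewrite Eu; ring].
Qed.

(** With [q = p] and [x = p^c] these are the weights [w_k]. *)
Definition qratio (q x : R) (k : nat) : R := (1 - x ^ k) / (1 - q ^ k).

Lemma pow_S_lt_1 (x : R) (k : nat) : 0 < x < 1 -> 0 < x ^ S k < 1.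
Proof.
  intros hx. split; [apply pow_lt; lra|].
  destruct (pow_lt_1_compat x (S k)); [lra|lia|assumption].
Qed.

Lemma qratio_0 (q x : R) : qratio q x 0 = 0.
Proof. unfold qratio; rewrite !pow_O; unfold Rdiv; ring. Qed.

Lemma qratio_pos (q x : R) (k : nat) : 0 < q < 1 -> 0 < x < 1 -> 0 < qratio q x (S k).
Proof.
  intros hq hx. pose proof (pow_S_lt_1 q k hq). pose proof (pow_S_lt_1 x k hx).
  apply Rdiv_lt_0_compat; lra.
Qed.

(** Since [(1 - x^n) (1 - x^(n+2)) = (1 - x^(n+1))^2 - x^n (1 - x)^2], log-concavity says that
    [x^n (1 - x)^2 / (1 - x^(n+1))^2] is at least its value at [q]. This is the inverse square of
    the normalized geometric sum, so [geometric_sum_normalized_decr] applies at the square roots of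
    [x] and [q]. *)
Lemma qratio_log_concave (q x : R) (k : nat) : 0 < q -> q <= x -> x < 1 ->
  qratio q x (S k) * qratio q x (S (S (S k))) <= qratio q x (S (S k)) ^ 2.
Proof.
  intros hq hqx hx.
  assert (hs : sqrt q ^ S k * sum_f_R0 (pow x) (S k) <= sqrt x ^ S k * sum_f_R0 (pow q) (S k)).
  { rewrite <- (sqrt_sqrt x) at 1 by lra. rewrite <- (sqrt_sqrt q) at 2 by lra.
    apply geometric_sum_normalized_decr.
    - apply sqrt_lt_R0; lra.
    - apply sqrt_le_1_alt; lra.
    - rewrite <- sqrt_1. apply sqrt_lt_1_alt; lra. }
  assert (hs0 : 0 <= sqrt q ^ S k * sum_f_R0 (pow x) (S k)).
  { apply Rmult_le_pos; [apply pow_le, sqrt_pos|].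
    apply cond_pos_sum; intros; apply pow_le; lra. }
  apply (Rmult_le_compat _ _ _ _ hs0 hs0 hs) in hs.
  assert (sq : forall t, 0 < t -> sqrt t ^ S k * sqrt t ^ S k = t ^ S k)
    by (intros t ht; rewrite <- Rpow_mult_distr, sqrt_sqrt; lra).
  assert (geo : forall t, t < 1 -> sum_f_R0 (pow t) (S k) * (1 - t) = 1 - t ^ S (S k))
    by (intros t ht; rewrite tech3 by lra; field; lra).
  pose proof (pow_S_lt_1 q k ltac:(lra)). pose proof (pow_S_lt_1 q (S k) ltac:(lra)).
  pose proof (pow_S_lt_1 q (S (S k)) ltac:(lra)).
  assert (key : q ^ S k * (1 - q) ^ 2 * (1 - x ^ S (S k)) ^ 2
    <= x ^ S k * (1 - x) ^ 2 * (1 - q ^ S (S k)) ^ 2).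
  { rewrite <- (geo q), <- (geo x), <- (sq q), <- (sq x) by lra.
    assert (h0 : 0 <= (1 - q) ^ 2 * (1 - x) ^ 2) by (apply Rmult_le_pos; apply pow2_ge_0).
    apply (Rmult_le_compat_l _ _ _ h0) in hs. lra. }
  unfold qratio.
  replace ((1 - x ^ S k) / (1 - q ^ S k) * ((1 - x ^ S (S (S k))) / (1 - q ^ S (S (S k)))))
    with ((1 - x ^ S k) * (1 - x ^ S (S (S k))) / ((1 - q ^ S k) * (1 - q ^ S (S (S k)))))
    by (field; lra).
  replace (((1 - x ^ S (S k)) / (1 - q ^ S (S k))) ^ 2)
    with ((1 - x ^ S (S k)) ^ 2 / (1 - q ^ S (S k)) ^ 2) by (field; lra).
  apply <- Rle_div_l; [|apply Rmult_lt_0_compat; lra].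
  match goal with |- _ <= ?a / ?b * ?c => replace (a / b * c) with (a * c / b) by (field; lra) end.
  apply -> Rle_div_r; [|apply pow_lt; lra].
  change (x ^ S (S (S k))) with (x * (x * x ^ S k)) in *.
  change (q ^ S (S (S k))) with (q * (q * q ^ S k)) in *.
  change (x ^ S (S k)) with (x * x ^ S k) in *.
  change (q ^ S (S k)) with (q * q ^ S k) in *.
  lra.
Qed.

(** The ratios [w (S k) / w k] decrease over positive indices; the statement is their comparison at
    [a] and [b] with denominators cleared. *)
Lemma log_concave_shift (w : nat -> R) :
  (forall k, 0 < w (S k)) ->
  (forall k, w (S k) * w (S (S (S k))) <= w (S (S k)) ^ 2) ->
  forall a b, (1 <= a <= b)%nat -> w a * w (S b) <= w (S a) * w b.
Proof.
  intros hpos hlc a b [ha hab]. induction hab as [|b hab IH].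
  - apply Req_le; ring.
  - destruct b as [|b]; [lia|].
    apply (Rmult_le_reg_r (w (S b) * w (S (S b))));
      [apply Rmult_lt_0_compat; apply hpos|].
    specialize (hlc b). destruct a as [|a]; [lia|].
    apply Rle_trans with (w (S a) * w (S (S b)) * w (S (S b)) ^ 2).
    + replace (w (S a) * w (S (S (S b))) * (w (S b) * w (S (S b))))
        with (w (S a) * w (S (S b)) * (w (S b) * w (S (S (S b))))) by ring.
      apply Rmult_le_compat_l; [|exact hlc].
      apply Rmult_le_pos; left; apply hpos.
    + replace (w (S (S a)) * w (S (S b)) * (w (S b) * w (S (S b))))
        with (w (S (S a)) * w (S b) * w (S (S b)) ^ 2) by ring.
      apply Rmult_le_compat_r; [apply pow2_ge_0|exact IH].
Qed.

Lemma log_concave_inward (w : nat -> R) :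
  (forall a b, (1 <= a <= b)%nat -> w a * w (S b) <= w (S a) * w b) ->
  forall N i j, (1 <= i <= j)%nat -> (j <= N - j)%nat ->
    w i * w (N - i)%nat <= w j * w (N - j)%nat.
Proof.
  intros hlc N i j [hi hij] hj. induction hij as [|j hij IH]; [lra|].
  eapply Rle_trans; [apply IH; lia|].
  replace (N - j)%nat with (S (N - S j)) by lia. apply hlc; lia.
Qed.

(** * Weighted sums whose weights separate the signs *)

(** Take for [t] the largest weight at an index where [D] is negative, or 0 if there is none; no
    weight at a positive value of [D] lies below it. Replacing all weights by [t] then only lowers
    the sum. *)
Lemma threshold_exists (W D : nat -> R) (N : nat) :
  (forall j, (j <= N)%nat -> 0 <= W j) ->
  (forall i j, (i <= N)%nat -> (j <= N)%nat -> D i < 0 -> 0 < D j -> W i <= W j) ->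
  exists t, 0 <= t /\ forall j, (j <= N)%nat -> t * D j <= W j * D j.
Proof.
  intros hW hWD.
  assert (H : forall n, (n <= N)%nat -> exists t, 0 <= t
    /\ (forall i, (i <= n)%nat -> D i < 0 -> W i <= t)
    /\ (t = 0 \/ exists i, (i <= n)%nat /\ D i < 0 /\ t = W i)).
  { induction n as [|n IH]; intros hn.
    - destruct (Rlt_le_dec (D 0%nat) 0) as [h|h].
      + exists (W 0%nat). repeat split; [apply hW; lia| |right; exists 0%nat; auto].
        intros i hi _. replace i with 0%nat by lia. lra.
      + exists 0. repeat split; [lra| |left; reflexivity].
        intros i hi. replace i with 0%nat by lia. lra.
    - destruct IH as (t & ht0 & ht1 & ht2); [lia|].
      destruct (Rlt_le_dec (D (S n)) 0) as [h|h];
        [destruct (Rle_lt_dec (W (S n)) t) as [h'|h']|].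
      + exists t. repeat split; [exact ht0| |].
        * intros i hi hD. destruct (Nat.eq_dec i (S n)) as [->|]; [exact h'|].
          apply ht1; [lia|exact hD].
        * destruct ht2 as [|(i & ? & ?)]; [now left|right; exists i; split; [lia|assumption]].
      + exists (W (S n)). repeat split; [lra| |right; exists (S n); auto].
        intros i hi hD. destruct (Nat.eq_dec i (S n)) as [->|]; [lra|].
        specialize (ht1 i ltac:(lia) hD); lra.
      + exists t. repeat split; [exact ht0| |].
        * intros i hi hD. destruct (Nat.eq_dec i (S n)) as [->|]; [lra|].
          apply ht1; [lia|exact hD].
        * destruct ht2 as [|(i & ? & ?)]; [now left|right; exists i; split; [lia|assumption]]. }
  destruct (H N (le_n N)) as (t & ht0 & ht1 & ht2).
  exists t; split; [exact ht0|]. intros j hj.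
  destruct (Rtotal_order (D j) 0) as [h|[h|h]].
  - specialize (ht1 j hj h). nra.
  - rewrite h; lra.
  - apply Rmult_le_compat_r; [lra|]. destruct ht2 as [->|(i & hi & hD & ->)];
      [apply hW, hj|apply hWD; assumption].
Qed.

Lemma weighted_sum_ge0 (W D : nat -> R) (N : nat) :
  (forall j, (j <= N)%nat -> 0 <= W j) ->
  (forall i j, (i <= N)%nat -> (j <= N)%nat -> D i < 0 -> 0 < D j -> W i <= W j) ->
  0 <= sum_f_R0 D N -> 0 <= sum_f_R0 (fun j => W j * D j) N.
Proof.
  intros hW hWD hD. destruct (threshold_exists W D N hW hWD) as (t & ht & h).
  apply Rle_trans with (t * sum_f_R0 D N); [apply Rmult_le_pos; assumption|].
  rewrite scal_sum. apply sum_Rle; intros j hj. rewrite Rmult_comm. apply h, hj.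
Qed.

(* (u^a + u^b) / (1 + u^(a+b)) increases on [0,1], so the difference changes
   sign at most once. *)
Lemma pow_sum_sign_change (A B u v : R) (a b : nat) :
  0 <= A -> 0 <= u -> u <= v -> v <= 1 ->
  0 <= A * (u ^ a + u ^ b) - B * (1 + u ^ (a + b)) ->
  0 <= A * (v ^ a + v ^ b) - B * (1 + v ^ (a + b)).
Proof.
  intros hA hu huv hv h. rewrite !pow_add in *.
  assert (le1 : forall x n, 0 <= x <= 1 -> 0 <= x ^ n <= 1).
  { intros x n hx. split; [apply pow_le; lra|].
    rewrite <- (pow1 n); apply pow_incr; exact hx. }
  pose proof (le1 u a ltac:(lra)). pose proof (le1 u b ltac:(lra)).
  pose proof (le1 v a ltac:(lra)). pose proof (le1 v b ltac:(lra)).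
  pose proof (pow_incr u v a ltac:(lra)). pose proof (pow_incr u v b ltac:(lra)).
  set (ua := u ^ a) in *. set (ub := u ^ b) in *.
  set (va := v ^ a) in *. set (vb := v ^ b) in *.
  (* The products in [h1] and [h2] add up to [(va + vb) (1 + ua ub) - (ua + ub) (1 + va vb)], the
     cross-multiplied comparison of the two ratios. *)
  assert (h1 : 0 <= (va - ua) * (1 - ub * vb)) by (apply Rmult_le_pos; nra).
  assert (h2 : 0 <= (vb - ub) * (1 - ua * va)) by (apply Rmult_le_pos; nra).
  assert (hab : 0 <= ua * ub) by nra. assert (hab' : 0 <= va * vb) by nra.
  apply (Rmult_le_reg_r (1 + ua * ub)); [lra|].
  rewrite Rmult_0_l.
  assert (h3 : 0 <= A * ((va - ua) * (1 - ub * vb) + (vb - ub) * (1 - ua * va)))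
    by (apply Rmult_le_pos; lra).
  assert (h4 := Rmult_le_pos (1 + va * vb) _ ltac:(lra) h).
  lra.
Qed.

(** * Sign pattern of the symmetrized coefficients *)

Lemma divpow_mult_ratio (p k j h : nat) :
  divpow p (S j) * divpow k (S h) =
  INR (S h) ^ (p + k) * / (INR (fact p) * INR (fact k)) * (INR (S j) / INR (S h)) ^ p.
Proof.
  rewrite !divpow_pos. unfold Rdiv. rewrite Rpow_mult_distr, pow_inv, pow_add. field.
  repeat split; try apply INR_fact_neq_0. apply pow_nonzero, not_0_INR; lia.
Qed.

(** This is [d(j, N-j) + d(N-j, j)], with exponents [p = m-1], [k = n-1], [p' = r-1], [k' = s-1]. *)
Definition symdiff (p k p' k' N j : nat) : R :=
  divpow p j * divpow k (N - j) + divpow k j * divpow p (N - j)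
  - (divpow p' j * divpow k' (N - j) + divpow k' j * divpow p' (N - j)).

(** All products have the same total degree, so up to a positive factor only the ratio [u] of the
    two indices matters. What remains has the form treated by [pow_sum_sign_change]. *)
Lemma symdiff_factor (a b s j h : nat) :
  let u := INR (S j) / INR (S h) in
  symdiff (s + a) (s + b) (s + a + b) s (S j + S h) (S j) =
  INR (S h) ^ (s + a + b + s) * u ^ s *
  (/ (INR (fact (s + a)) * INR (fact (s + b))) * (u ^ a + u ^ b)
   - / (INR (fact (s + a + b)) * INR (fact s)) * (1 + u ^ (a + b))).
Proof.
  intros u. unfold symdiff. replace (S j + S h - S j)%nat with (S h) by lia.
  rewrite !divpow_mult_ratio. fold u.
  replace (s + a + (s + b))%nat with (s + a + b + s)%nat by lia.
  replace (s + b + (s + a))%nat with (s + a + b + s)%nat by lia.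
  replace (s + (s + a + b))%nat with (s + a + b + s)%nat by lia.
  rewrite !(Rmult_comm (INR (fact (s + b)))), !(Rmult_comm (INR (fact s))).
  set (H := INR (S h) ^ (s + a + b + s)).
  rewrite !pow_add. ring.
Qed.

Lemma symdiff_inward (a b s N i j : nat) :
  (1 <= j <= i)%nat -> (i <= N - i)%nat ->
  0 < symdiff (s + a) (s + b) (s + a + b) s N j ->
  0 <= symdiff (s + a) (s + b) (s + a + b) s N i.
Proof.
  intros hji hi hj.
  assert (E : forall l, (1 <= l <= i)%nat -> exists l' h, l = S l' /\ N = (S l' + S h)%nat).
  { intros l hl. exists (l - 1)%nat, (N - l - 1)%nat. lia. }
  destruct (E j ltac:(lia)) as (j' & h & -> & EN).
  destruct (E i ltac:(lia)) as (i' & g & -> & EN').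
  rewrite EN in hj. rewrite EN'. rewrite symdiff_factor in *.
  assert (pos : forall n, 0 < INR (S n)) by (intros n; apply lt_0_INR; lia).
  assert (hu : 0 < INR (S j') / INR (S h)) by (apply Rdiv_lt_0_compat; apply pos).
  assert (hv : 0 < INR (S i') / INR (S g)) by (apply Rdiv_lt_0_compat; apply pos).
  apply Rmult_le_pos; [left; apply Rmult_lt_0_compat; apply pow_lt; auto|].
  apply (pow_sum_sign_change _ _ (INR (S j') / INR (S h))).
  - left; apply Rinv_0_lt_compat, Rmult_lt_0_compat; apply INR_fact_lt_0.
  - lra.
  - apply Rmult_le_compat; [left; apply pos|left; apply Rinv_0_lt_compat, pos| |].
    + apply le_INR; lia.
    + apply Rinv_le_contravar; [apply pos|apply le_INR; lia].
  - apply <- Rle_div_l; [|apply pos]. rewrite Rmult_1_l. apply le_INR; lia.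
  - apply Rnot_lt_le. intros hneg.
    assert (hc : 0 < INR (S h) ^ (s + a + b + s) * (INR (S j') / INR (S h)) ^ s)
      by (apply Rmult_lt_0_compat; apply pow_lt; auto).
    apply Rlt_not_le in hj. apply hj.
    rewrite <- (Rmult_0_r (INR (S h) ^ (s + a + b + s) * (INR (S j') / INR (S h)) ^ s)).
    apply Rmult_le_compat_l; lra.
Qed.

Lemma symdiff_sym (p k p' k' N j : nat) : (j <= N)%nat ->
  symdiff p k p' k' N (N - j) = symdiff p k p' k' N j.
Proof.
  intros hj. unfold symdiff. replace (N - (N - j))%nat with j by lia. ring.
Qed.

Lemma conv_log_concave_ge (w : nat -> R) (a b s N : nat) :
  w 0%nat = 0 -> (forall k, 0 < w (S k)) ->
  (forall k, w (S k) * w (S (S (S k))) <= w (S (S k)) ^ 2) ->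
  cpow (s + a + b) s N <= cpow (s + a) (s + b) N ->
  conv (fun j => w j * divpow (s + a + b) j) (fun j => w j * divpow s j) N
  <= conv (fun j => w j * divpow (s + a) j) (fun j => w j * divpow (s + b) j) N.
Proof.
  intros h0 hpos hlc hc.
  assert (hw : forall k, 0 <= w k) by (intros [|k]; [lra|left; apply hpos]).
  set (D := symdiff (s + a) (s + b) (s + a + b) s N).
  (* Both [D] and the weight product are invariant under [j -> N - j], so an index can be moved to
     the lower half. The ends [0] and [N] are excluded because [divpow] vanishes at 0. *)
  assert (hfold : forall j, (j <= N)%nat -> D j <> 0 -> exists l,
    (1 <= l <= N - l)%nat /\ D l = D j /\ w l * w (N - l)%nat = w j * w (N - j)%nat).
  { intros j hj hD.
    assert (j <> 0)%nat by (intros ->; apply hD; unfold D, symdiff; simpl divpow; ring).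
    assert (j <> N)%nat.
    { intros ->; apply hD; unfold D, symdiff; rewrite Nat.sub_diag; simpl divpow; ring. }
    destruct (Nat.le_ge_cases j (N - j)) as [h|h].
    - exists j; repeat split; lia.
    - exists (N - j)%nat. split; [lia|]. split; [apply symdiff_sym, hj|].
      replace (N - (N - j))%nat with j by lia. ring. }
  assert (hsum : 0 <= sum_f_R0 (fun j => (w j * w (N - j)%nat) * D j) N).
  { apply weighted_sum_ge0.
    - intros; apply Rmult_le_pos; apply hw.
    - intros i j hi hj hDi hDj.
      destruct (hfold i hi ltac:(lra)) as (i' & hi' & Ei & <-).
      destruct (hfold j hj ltac:(lra)) as (j' & hj' & Ej & <-).
      apply log_concave_inward; [apply log_concave_shift; assumption| |lia].
      (* If the negative index [i'] lay further inward than the positive index [j'],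
         [symdiff_inward] would force [D i' >= 0]. *)
      split; [lia|]. apply Nat.nlt_ge. intros hlt.
      assert (0 <= D i') by (apply (symdiff_inward a b s N i' j'); [lia|lia|fold D; lra]).
      lra.
    - unfold D, symdiff. rewrite minus_sum, !sum_plus.
      fold (cpow (s + a) (s + b) N) (cpow (s + b) (s + a) N)
        (cpow (s + a + b) s N) (cpow s (s + a + b) N).
      change (0 <= cpow (s + a) (s + b) N + cpow (s + b) (s + a) N
        - (cpow (s + a + b) s N + cpow s (s + a + b) N)).
      rewrite (cpow_comm (s + b)), (cpow_comm s). lra. }
  set (f := fun k j => w j * divpow k j).
  change (conv (f (s + a + b)%nat) (f s) N <= conv (f (s + a)%nat) (f (s + b)%nat) N).
  (* Symmetrizing counts each convolution twice, so the nonnegative sum is twice the wanted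
     difference. *)
  enough (sum_f_R0 (fun j => (w j * w (N - j)%nat) * D j) N =
    conv (f (s + a)%nat) (f (s + b)%nat) N + conv (f (s + b)%nat) (f (s + a)%nat) N
    - (conv (f (s + a + b)%nat) (f s) N + conv (f s) (f (s + a + b)%nat) N)).
  { rewrite (conv_comm (f (s + b)%nat)), (conv_comm (f s)) in H. lra. }
  unfold conv. rewrite <- !sum_plus, <- minus_sum.
  apply sum_eq; intros j hj. unfold D, symdiff, f. ring.
Qed.

(** * Series in powers of p^x *)

Lemma CV_radius_ge_1_bounded (a : nat -> R) (M : R) :
  (forall k, Rabs (a k) <= M) -> Rbar_le 1 (CV_radius a).
Proof.
  intros h. apply (proj1 (CV_radius_bounded a)). exists M; intros k.
  rewrite pow1, Rmult_1_r. apply h.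
Qed.

Lemma CV_radius_ge_1_pseries (a : nat -> R) :
  (forall z, 0 <= z < 1 -> ex_pseries a z) -> Rbar_le 1 (CV_radius a).
Proof.
  intros h. apply Rbar_not_lt_le. intros hlt.
  pose proof (CV_radius_ge_0 a) as h0.
  destruct (CV_radius a) as [r| |] eqn:E; simpl in hlt, h0; try contradiction.
  (* If the radius [r] were below 1, the midpoint of [r] and 1 would lie outside the disk, yet the
     series converges there and its terms tend to 0. *)
  apply (CV_disk_outside a ((r + 1) / 2)).
  - rewrite E, Rabs_pos_eq by lra. simpl; lra.
  - apply ex_series_lim_0. apply ex_pseries_R. apply h. lra.
Qed.

Lemma CV_radius_ge_1_inside (a : nat -> R) (z : R) :
  Rbar_le 1 (CV_radius a) -> 0 <= z < 1 -> Rbar_lt (Rabs z) (CV_radius a).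
Proof.
  intros h hz. apply Rbar_lt_le_trans with (2 := h).
  simpl. rewrite Rabs_pos_eq; lra.
Qed.

(** These are the coefficients of [z a'(z)]; differentiating and shifting both preserve the
    radius. *)
Lemma CV_radius_ge_1_INR (a : nat -> R) :
  Rbar_le 1 (CV_radius a) -> Rbar_le 1 (CV_radius (fun k => INR k * a k)).
Proof.
  intros h. rewrite (CV_radius_ext _ (PS_incr_1 (PS_derive a))).
  - rewrite CV_radius_incr_1, CV_radius_derive. exact h.
  - intros [|k]; [apply Rmult_0_l|reflexivity].
Qed.

Lemma CV_radius_ge_1_pow (a : nat -> R) (n : nat) :
  Rbar_le 1 (CV_radius a) -> Rbar_le 1 (CV_radius (fun k => INR k ^ n * a k)).
Proof.
  intros h. induction n as [|n IH].
  - rewrite (CV_radius_ext _ a); [exact h|]. intros; simpl; ring.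
  - rewrite (CV_radius_ext _ (fun k => INR k * (INR k ^ n * a k)));
      [apply CV_radius_ge_1_INR, IH|]. intros; simpl; ring.
Qed.

Lemma CV_radius_ge_1_mult (a b : nat -> R) :
  Rbar_le 1 (CV_radius a) -> Rbar_le 1 (CV_radius b) ->
  Rbar_le 1 (CV_radius (PS_mult a b)).
Proof.
  intros ha hb. apply CV_radius_ge_1_pseries. intros z hz.
  apply ex_pseries_mult; apply CV_radius_ge_1_inside; assumption.
Qed.

Lemma CV_radius_ge_1_minus (a b : nat -> R) :
  Rbar_le 1 (CV_radius a) -> Rbar_le 1 (CV_radius b) ->
  Rbar_le 1 (CV_radius (PS_minus a b)).
Proof.
  intros ha hb. apply CV_radius_ge_1_pseries. intros z hz.
  apply ex_pseries_minus; apply CV_radius_inside, CV_radius_ge_1_inside; assumption.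
Qed.

Lemma Rpower_lt_1 (p x : R) : 0 < p < 1 -> 0 < x -> 0 < Rpower p x < 1.
Proof.
  intros hp hx. split; [apply exp_pos|]. unfold Rpower. rewrite <- exp_0.
  apply exp_increasing. assert (ln p < 0) by (rewrite <- ln_1; apply ln_increasing; lra).
  nra.
Qed.

Lemma Rpower_inside (a : nat -> R) (p x : R) : Rbar_le 1 (CV_radius a) ->
  0 < p < 1 -> 0 < x -> Rbar_lt (Rabs (Rpower p x)) (CV_radius a).
Proof.
  intros h hp hx. apply CV_radius_ge_1_inside; [exact h|].
  pose proof (Rpower_lt_1 p x hp hx); lra.
Qed.

Lemma is_derive_PSeries_Rpower (a : nat -> R) (p x : R) :
  Rbar_le 1 (CV_radius a) -> 0 < p < 1 -> 0 < x ->
  is_derive (fun t => PSeries a (Rpower p t)) x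
    (ln p * PSeries (fun k => INR k * a k) (Rpower p x)).
Proof.
  intros ha hp hx.
  replace (ln p * PSeries (fun k => INR k * a k) (Rpower p x))
    with (ln p * Rpower p x * PSeries (PS_derive a) (Rpower p x)).
  - apply (is_derive_comp (PSeries a) (Rpower p)).
    + apply is_derive_PSeries, Rpower_inside; assumption.
    + unfold Rpower. auto_derive; [trivial|ring].
  - rewrite Rmult_assoc, <- PSeries_incr_1. f_equal. apply PSeries_ext.
    intros [|k]; [symmetry; apply Rmult_0_l|reflexivity].
Qed.

Lemma locally_pos (P : R -> Prop) (x : R) :
  0 < x -> (forall t, 0 < t -> P t) -> locally x P.
Proof.
  intros hx h. apply (locally_interval P x 0 p_infty); simpl; auto.
Qed.

Lemma is_derive_n_PSeries_Rpower (f : R -> R) (a : nat -> R) (p K : R) :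
  Rbar_le 1 (CV_radius a) -> 0 < p < 1 ->
  (forall x, 0 < x -> f x = K * PSeries a (Rpower p x)) ->
  forall n x, 0 < x ->
    is_derive_n f n x (K * ln p ^ n * PSeries (fun k => INR k ^ n * a k) (Rpower p x)).
Proof.
  intros ha hp hf n. induction n as [|n IH]; intros x hx.
  - simpl. rewrite hf by exact hx. rewrite Rmult_1_r. f_equal.
    apply PSeries_ext; intros; ring.
  - apply (is_derive_ext_loc
      (fun t => K * ln p ^ n * PSeries (fun k => INR k ^ n * a k) (Rpower p t))).
    + apply locally_pos; [exact hx|]. intros t ht. symmetry.
      apply is_derive_n_unique, IH, ht.
    + replace (K * ln p ^ S n * PSeries (fun k => INR k ^ S n * a k) (Rpower p x))
        with (K * ln p ^ n * (ln p * PSeries (fun k => INR k * (INR k ^ n * a k)) (Rpower p x))).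
      * apply is_derive_scal, is_derive_PSeries_Rpower; [|exact hp|exact hx].
        apply CV_radius_ge_1_pow, ha.
      * rewrite (PSeries_ext (fun k => INR k ^ S n * a k) (fun k => INR k * (INR k ^ n * a k)))
          by (intros; simpl; ring). simpl; ring.
Qed.

Lemma PSeries_ge0 (a : nat -> R) (z : R) :
  Rbar_le 1 (CV_radius a) -> 0 <= z < 1 -> (forall k, 0 <= a k) -> 0 <= PSeries a z.
Proof.
  intros ha hz h. unfold PSeries.
  apply Rle_trans with (Series (fun k => 0 * (a k * z ^ k))).
  - rewrite Series_scal_l. lra.
  - apply Series_le.
    + intros k. rewrite Rmult_0_l. split; [lra|].
      apply Rmult_le_pos; [apply h|apply pow_le; lra].
    + apply ex_pseries_R, CV_radius_inside, CV_radius_ge_1_inside; assumption.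
Qed.

(** Each derivative multiplies the coefficient of index [j] by [j ln p], which is nonpositive, so
    the factor [(-1)^k] cancels the signs. *)
Lemma completely_monotonic_PSeries_Rpower (f : R -> R) (a : nat -> R) (p K : R) :
  Rbar_le 1 (CV_radius a) -> 0 < p < 1 -> 0 <= K -> (forall k, 0 <= a k) ->
  (forall x, 0 < x -> f x = K * PSeries a (Rpower p x)) ->
  completely_monotonic f 0 p_infty.
Proof.
  intros ha hp hK ha0 hf k x hx _. simpl in hx.
  pose proof (is_derive_n_PSeries_Rpower f a p K ha hp hf k x hx) as hd.
  split.
  - destruct k as [|k]; [exact I|]. eexists; exact hd.
  - rewrite (is_derive_n_unique _ _ _ _ hd).
    replace ((-1) ^ k * (K * ln p ^ k * PSeries (fun j => INR j ^ k * a j) (Rpower p x)))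
      with (K * (- ln p) ^ k * PSeries (fun j => INR j ^ k * a j) (Rpower p x)).
    + apply Rmult_le_pos; [apply Rmult_le_pos; [exact hK|]|].
      * apply pow_le. assert (ln p < 0) by (rewrite <- ln_1; apply ln_increasing; lra). lra.
      * apply PSeries_ge0; [apply CV_radius_ge_1_pow, ha| |].
        -- pose proof (Rpower_lt_1 p x hp hx); lra.
        -- intros j. apply Rmult_le_pos; [apply pow_le, pos_INR|apply ha0].
    + replace (- ln p) with (-1 * ln p) by ring. rewrite Rpow_mult_distr. ring.
Qed.

(** * Power series of the logarithm of the q-gamma function *)

(** Coefficients of [- sum_n ln (1 - p^n z)] in powers of [z]: the expansion of each logarithm gives
    [p^(nk) / k], and the sum over [n] is geometric. The inverse of 0 being 0, the constant term
    vanishes. *)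
Definition lngamma_coef (p : R) (k : nat) : R := / (INR k * (1 - p ^ k)).

Lemma lngamma_coef_0 (p : R) : lngamma_coef p 0 = 0.
Proof. unfold lngamma_coef. simpl. rewrite Rmult_0_l. apply Rinv_0. Qed.

Lemma pow_S_le (p : R) (k : nat) : 0 < p < 1 -> p ^ S k <= p.
Proof.
  intros hp. assert (p ^ k <= 1) by (rewrite <- (pow1 k); apply pow_incr; lra).
  simpl. nra.
Qed.

Lemma CV_radius_lngamma_coef (p : R) : 0 < p < 1 -> Rbar_le 1 (CV_radius (lngamma_coef p)).
Proof.
  intros hp. apply (CV_radius_ge_1_bounded _ (/ (1 - p))). intros [|k].
  - rewrite lngamma_coef_0, Rabs_R0. left; apply Rinv_0_lt_compat; lra.
  - pose proof (pow_S_le p k hp). unfold lngamma_coef.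
    assert (1 <= INR (S k)) by (rewrite S_INR; pose proof (pos_INR k); lra).
    rewrite Rabs_pos_eq.
    + apply Rinv_le_contravar; [lra|]. nra.
    + left; apply Rinv_0_lt_compat. nra.
Qed.

(** This functional equation makes the product telescope. The derivative of the left side is the
    geometric series, because the factors [1 - p^k] cancel; hence [H] has zero derivative on
    [[0, z]]. *)
Lemma PSeries_lngamma_coef_step (p z : R) : 0 < p < 1 -> 0 < z < 1 ->
  PSeries (lngamma_coef p) z - PSeries (lngamma_coef p) (p * z) = - ln (1 - z).
Proof.
  intros hp hz. set (a := lngamma_coef p).
  assert (ha := CV_radius_lngamma_coef p hp). fold a in ha.
  set (H := fun t => PSeries a t - PSeries a (p * t) + ln (1 - t)).
  assert (E : H 0 = H z).
  { apply (eq_is_derive H); [|lra]. intros t ht.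
    assert (hpt : 0 <= p * t < 1) by nra.
    assert (d : is_derive H t (PSeries (PS_derive a) t
      - p * PSeries (PS_derive a) (p * t) + - / (1 - t))).
    { apply (is_derive_plus (V := R_NormedModule) (fun t => PSeries a t - PSeries a (p * t))).
      - apply (is_derive_minus (V := R_NormedModule) (PSeries a)).
        + apply is_derive_PSeries, CV_radius_ge_1_inside; [exact ha|lra].
        + apply (is_derive_comp (PSeries a) (fun t => p * t)).
          * apply is_derive_PSeries, CV_radius_ge_1_inside; [exact ha|lra].
          * auto_derive; [trivial|ring].
      - auto_derive; [lra|field; lra]. }
    replace (@zero R_NormedModule) with (PSeries (PS_derive a) t
      - p * PSeries (PS_derive a) (p * t) + - / (1 - t)); [exact d|].
    assert (ex : forall u, 0 <= u < 1 -> ex_series (fun k => PS_derive a k * u ^ k)).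
    { intros u hu. apply ex_pseries_R, CV_radius_inside, CV_radius_ge_1_inside; [|exact hu].
      rewrite CV_radius_derive. exact ha. }
    unfold PSeries. rewrite <- Series_scal_l, <- Series_minus.
    + rewrite (Series_ext _ (fun k => t ^ k)).
      * rewrite Series_geom by (rewrite Rabs_pos_eq; lra).
        change (@zero R_NormedModule) with 0. ring.
      * intros k. unfold PS_derive, a, lngamma_coef. rewrite Rpow_mult_distr.
        pose proof (pow_S_lt_1 p k hp). simpl pow in *. field.
        split; [lra|apply not_0_INR; lia].
    + apply ex; lra.
    + apply (ex_series_scal (K := R_AbsRing) (V := R_NormedModule)), ex, hpt. }
  unfold H in E. rewrite Rmult_0_r, Rminus_diag, Rminus_0_r, ln_1 in E. lra.
Qed.

Lemma qgamma_partial_product (p x : R) (N : nat) : 0 < p < 1 -> 0 < x ->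
  let G t := PSeries (lngamma_coef p) (Rpower p t) in
  prod_f_R0 (fun n => (1 - Rpower p (INR n + 1)) / (1 - Rpower p (INR n + x))) N
  = exp (G x - G 1 - (G (INR (S N) + x) - G (INR (S N) + 1))).
Proof.
  intros hp hx G.
  assert (step : forall t n, 0 < t ->
    1 - Rpower p (INR n + t) = exp (G (INR (S n) + t) - G (INR n + t))).
  { intros t n ht. assert (hn : 0 < INR n + t) by (pose proof (pos_INR n); lra).
    pose proof (Rpower_lt_1 p (INR n + t) hp hn) as hz.
    pose proof (PSeries_lngamma_coef_step p (Rpower p (INR n + t)) hp hz) as h.
    replace (p * Rpower p (INR n + t)) with (Rpower p (INR (S n) + t)) in h.
    - fold (G (INR n + t)) (G (INR (S n) + t)) in h.
      rewrite <- (exp_ln (1 - Rpower p (INR n + t))) by lra. f_equal. lra.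
    - rewrite S_INR. replace (INR n + 1 + t) with (1 + (INR n + t)) by ring.
      rewrite Rpower_plus, Rpower_1 by lra. reflexivity. }
  assert (step' : forall n, (1 - Rpower p (INR n + 1)) / (1 - Rpower p (INR n + x))
    = exp (G (INR (S n) + 1) - G (INR n + 1) - (G (INR (S n) + x) - G (INR n + x)))).
  { intros n. rewrite !step by lra. unfold Rdiv. rewrite <- exp_Ropp, <- exp_plus.
    f_equal; ring. }
  induction N as [|N IH].
  - unfold prod_f_R0. rewrite (step' 0%nat). f_equal. simpl (INR 0). rewrite !Rplus_0_l. ring.
  - change (prod_f_R0 ?u (S N)) with (prod_f_R0 u N * u (S N)).
    cbv beta. rewrite IH, step', <- exp_plus. f_equal. ring.
Qed.

Lemma is_lim_seq_PSeries_Rpower (a : nat -> R) (p x : R) :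
  Rbar_le 1 (CV_radius a) -> 0 < p < 1 ->
  is_lim_seq (fun N => PSeries a (Rpower p (INR (S N) + x))) (PSeries a 0).
Proof.
  intros ha hp. apply (is_lim_seq_continuous (PSeries a)).
  - apply PSeries_continuity, CV_radius_ge_1_inside; [exact ha|lra].
  - apply (is_lim_seq_ext (fun N => Rpower p (1 + x) * p ^ N)).
    + intros N. rewrite <- Rpower_pow, <- Rpower_plus by lra.
      rewrite S_INR. f_equal. ring.
    + replace (Finite 0) with (Rbar_mult (Rpower p (1 + x)) 0) by (simpl; f_equal; ring).
      apply is_lim_seq_scal_l, is_lim_seq_geom. rewrite Rabs_pos_eq; lra.
Qed.

Lemma qgamma_infinite_product (p x : R) : 0 < p < 1 -> 0 < x ->
  infinite_product (fun n => (1 - Rpower p (INR n + 1)) / (1 - Rpower p (INR n + x)))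
  = exp (PSeries (lngamma_coef p) (Rpower p x) - PSeries (lngamma_coef p) (Rpower p 1)).
Proof.
  intros hp hx. unfold infinite_product.
  pose proof (CV_radius_lngamma_coef p hp) as ha. set (a := lngamma_coef p) in *.
  rewrite (is_lim_seq_unique _ (exp (PSeries a (Rpower p x) - PSeries a (Rpower p 1)))).
  { reflexivity. }
  apply (is_lim_seq_ext (fun N => exp (PSeries a (Rpower p x) - PSeries a (Rpower p 1)
    - (PSeries a (Rpower p (INR (S N) + x)) - PSeries a (Rpower p (INR (S N) + 1)))))).
  { intros N. symmetry. apply qgamma_partial_product; assumption. }
  apply (is_lim_seq_continuous exp).
  { apply derivable_continuous_pt, derivable_pt_exp. }
  (* Both remainders of the telescoped product tend to the value of the series at 0, so they cancel
     in the limit. *)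
  replace (PSeries a (Rpower p x) - PSeries a (Rpower p 1))
    with (PSeries a (Rpower p x) - PSeries a (Rpower p 1) - (PSeries a 0 - PSeries a 0)) at 1
    by ring.
  apply is_lim_seq_minus'; [apply is_lim_seq_const|].
  apply is_lim_seq_minus'; apply is_lim_seq_PSeries_Rpower; assumption.
Qed.

(** Equal to [1 / (1 - p^k)] for [k >= 1] and to 0 at [k = 0]; the product form is the one that
    differentiation yields. *)
Definition psi_coef (p : R) (k : nat) : R := INR k * lngamma_coef p k.

Lemma CV_radius_psi_coef (p : R) : 0 < p < 1 -> Rbar_le 1 (CV_radius (psi_coef p)).
Proof. intros hp. apply CV_radius_ge_1_INR, CV_radius_lngamma_coef, hp. Qed.

Lemma qpsi_of_ln_qGamma (q p A0 A1 A2 : R) : 0 < p < 1 ->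
  (forall x, 0 < x -> ln (qGamma q x) =
    A0 + A1 * x + A2 / 2 * x ^ 2 + PSeries (lngamma_coef p) (Rpower p x)) ->
  forall x, 0 < x -> qpsi q x = A1 + A2 * x + ln p * PSeries (psi_coef p) (Rpower p x).
Proof.
  intros hp h x hx. apply is_derive_unique.
  apply (is_derive_ext_loc (fun t => A0 + A1 * t + A2 / 2 * t ^ 2
    + PSeries (lngamma_coef p) (Rpower p t))).
  - apply locally_pos; [exact hx|]. intros t ht; symmetry; apply h, ht.
  - apply (is_derive_plus (V := R_NormedModule) (fun t => A0 + A1 * t + A2 / 2 * t ^ 2)).
    + auto_derive; [trivial|field].
    + apply is_derive_PSeries_Rpower; [apply CV_radius_lngamma_coef, hp|exact hp|exact hx].
Qed.

Lemma qpsi_PSeries (q : R) : 0 < q -> q <> 1 ->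
  exists p A B, 0 < p < 1 /\ (q < 1 -> B = 0) /\
    forall x, 0 < x -> qpsi q x = A + B * x + ln p * PSeries (psi_coef p) (Rpower p x).
Proof.
  intros hq hq1. destruct (Rlt_dec q 1) as [h|h].
  - exists q, (- ln (1 - q)), 0. split; [lra|]. split; [reflexivity|].
    set (c := PSeries (lngamma_coef q) (Rpower q 1)).
    apply (qpsi_of_ln_qGamma q q (ln (1 - q) - c)); [lra|].
    intros x hx. unfold qGamma. destruct (Rlt_dec q 1) as [_|]; [|contradiction].
    rewrite qgamma_infinite_product by lra.
    unfold Rpower at 1. rewrite <- exp_plus, ln_exp. fold c. field.
  - assert (hi : 0 < / q < 1).
    { split; [apply Rinv_0_lt_compat; lra|]. rewrite <- Rinv_1.
      apply Rinv_lt_contravar; lra. }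
    (* The slope [ln q] and the summand [- ln q / 2] come from differentiating the exponent of
       [q^(x(x-1)/2)]; the rest comes from [(q-1)^(1-x)]. *)
    exists (/ q), (- ln (q - 1) - ln q / 2), (ln q). split; [exact hi|].
    split; [lra|]. set (c := PSeries (lngamma_coef (/ q)) (Rpower (/ q) 1)).
    apply (qpsi_of_ln_qGamma q (/ q) (ln (q - 1) - c)); [exact hi|].
    intros x hx. unfold qGamma. destruct (Rlt_dec q 1) as [|_]; [contradiction|].
    replace (infinite_product _) with (infinite_product (fun n =>
      (1 - Rpower (/ q) (INR n + 1)) / (1 - Rpower (/ q) (INR n + x)))).
    + rewrite qgamma_infinite_product by assumption.
      unfold Rpower at 1 2. rewrite <- !exp_plus, ln_exp. fold c. field.
    + unfold infinite_product. f_equal. apply Lim_seq_ext; intros N.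
      assert (inv : forall t, Rpower (/ q) t = Rpower q (- t))
        by (intros t; unfold Rpower; rewrite ln_Rinv by lra; f_equal; ring).
      induction N as [|N IH]; simpl prod_f_R0; rewrite ?IH, !inv; reflexivity.
Qed.

Lemma is_derive_n_affine (A B : R) (j : nat) (x : R) :
  is_derive_n (fun t => A + B * t) j x
    match j with O => A + B * x | 1%nat => B | _ => 0 end.
Proof.
  destruct j as [|[|j]]; [reflexivity| |].
  - simpl. auto_derive; [trivial|ring].
  - revert x. induction j as [|j IH]; intros x.
    + simpl. apply (is_derive_ext (fun _ => B)).
      * intros t. symmetry. apply is_derive_unique. auto_derive; [trivial|ring].
      * apply (is_derive_const (V := R_NormedModule)).
    + apply (is_derive_ext (fun _ => 0)).
      * intros t. symmetry. apply is_derive_n_unique, IH.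
      * apply (is_derive_const (V := R_NormedModule)).
Qed.

Lemma qpolygamma_PSeries (q p A B : R) : 0 < p < 1 ->
  (forall x, 0 < x -> qpsi q x = A + B * x + ln p * PSeries (psi_coef p) (Rpower p x)) ->
  forall j x, 0 < x ->
    qpolygamma q j x =
    match j with O => A + B * x | 1%nat => B | _ => 0 end
    + ln p ^ S j * PSeries (fun k => INR k ^ j * psi_coef p k) (Rpower p x).
Proof.
  intros hp h j x hx. unfold qpolygamma.
  pose proof (is_derive_n_PSeries_Rpower (fun t => ln p * PSeries (psi_coef p) (Rpower p t))
    (psi_coef p) p (ln p) (CV_radius_psi_coef p hp) hp (fun _ _ => eq_refl)) as hd.
  rewrite (Derive_n_ext_loc _ (fun t => A + B * t + ln p * PSeries (psi_coef p) (Rpower p t))).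
  - rewrite Derive_n_plus.
    + rewrite (is_derive_n_unique _ _ _ _ (is_derive_n_affine A B j x)).
      rewrite (is_derive_n_unique _ _ _ _ (hd j x hx)). simpl. ring.
    + apply filter_forall. intros t k _. destruct k as [|k]; [exact I|].
      eexists; exact (is_derive_n_affine A B (S k) t).
    + apply locally_pos; [exact hx|]. intros t ht k _. destruct k as [|k]; [exact I|].
      eexists; exact (hd (S k) t ht).
  - apply locally_pos; [exact hx|]. exact h.
Qed.

(** * Difference quotients and the function [F] *)

Definition delta_coef (p c : R) (j k : nat) : R := qratio p (Rpower p c) k * divpow j k.

Lemma CV_radius_delta_coef (p c : R) (j : nat) : 0 < p < 1 -> 0 < c ->
  Rbar_le 1 (CV_radius (delta_coef p c j)).
Proof.
  intros hp hc. pose proof (Rpower_lt_1 p c hp hc) as hy.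
  rewrite (CV_radius_ext _ (PS_scal (/ INR (fact j))
    (fun k => INR k ^ j * qratio p (Rpower p c) k))).
  - rewrite CV_radius_scal by apply Rinv_neq_0_compat, INR_fact_neq_0.
    apply CV_radius_ge_1_pow, (CV_radius_ge_1_bounded _ (/ (1 - p))).
    intros [|k].
    + rewrite qratio_0, Rabs_R0. left; apply Rinv_0_lt_compat; lra.
    + rewrite Rabs_pos_eq by (left; apply qratio_pos; assumption).
      pose proof (pow_S_le p k hp). pose proof (pow_S_lt_1 (Rpower p c) k hy).
      unfold qratio. rewrite <- (Rmult_1_l (/ (1 - p))).
      apply Rmult_le_compat; [lra|left; apply Rinv_0_lt_compat; lra|lra|].
      apply Rinv_le_contravar; lra.
  - intros k. change (delta_coef p c j k
      = / INR (fact j) * (INR k ^ j * qratio p (Rpower p c) k)).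
    unfold delta_coef. destruct k as [|k]; [rewrite qratio_0; ring|].
    rewrite divpow_pos. unfold Rdiv. ring.
Qed.

(** Subtracting the value at [x + c] from that at [x] multiplies the coefficient of index [k] by
    [1 - p^(ck)], which together with [psi_coef] gives [qratio]. The affine part cancels for
    [j >= 1], where it is constant, and for [j = 0] once [B = 0]. *)
Lemma Delta_qpolygamma (q p A B c : R) : 0 < p < 1 -> 0 < c ->
  (forall x, 0 < x -> qpsi q x = A + B * x + ln p * PSeries (psi_coef p) (Rpower p x)) ->
  forall j x, 0 < x -> (j = 0%nat -> B = 0) ->
    Defs.Delta (qpolygamma q j) x c =
    - (ln p ^ S j * INR (fact j) / c) * PSeries (delta_coef p c j) (Rpower p x).
Proof.
  intros hp hc h j x hx hj. unfold Defs.Delta.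
  rewrite !(qpolygamma_PSeries q p A B hp h) by lra.
  set (b := fun k => INR k ^ j * psi_coef p k).
  assert (hb : Rbar_le 1 (CV_radius b)) by apply CV_radius_ge_1_pow, CV_radius_psi_coef, hp.
  pose proof (Rpower_lt_1 p x hp hx) as hz. pose proof (Rpower_lt_1 p c hp hc) as hy.
  assert (ex : forall u, 0 < u -> ex_series (fun k => b k * Rpower p u ^ k))
    by (intros u hu; apply ex_pseries_R, CV_radius_inside, Rpower_inside; assumption).
  assert (E : PSeries b (Rpower p x) - PSeries b (Rpower p (x + c))
    = INR (fact j) * PSeries (delta_coef p c j) (Rpower p x)).
  { rewrite <- PSeries_scal. unfold PSeries. rewrite <- Series_minus by (apply ex; lra).
    apply Series_ext; intros k. rewrite Rpower_plus, Rpow_mult_distr.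
    unfold b, psi_coef, lngamma_coef, delta_coef, qratio, PS_scal, scal; simpl;
      unfold mult; simpl.
    destruct k as [|k]; [simpl; unfold Rdiv; ring|].
    rewrite divpow_pos. pose proof (pow_S_lt_1 p k hp). field.
    repeat split; [apply INR_fact_neq_0|lra|apply not_0_INR; lia]. }
  assert (E0 : forall t, match j with O => A + B * t | 1%nat => B | _ => 0 end
    = match j with O => A | 1%nat => B | _ => 0 end).
  { intros t. destruct j as [|[|j]]; [rewrite hj by reflexivity; ring|reflexivity..]. }
  rewrite !E0. apply (Rmult_eq_reg_r c); [|lra].
  transitivity (- ln p ^ S j * (PSeries b (Rpower p x) - PSeries b (Rpower p (x + c))));
    [field; lra|]. rewrite E. field; lra.
Qed.

Lemma F_completely_monotonic (q c p A B : R) (a b s : nat) : 0 < p < 1 -> 0 < c -> c < 1 ->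
  (forall x, 0 < x -> qpsi q x = A + B * x + ln p * PSeries (psi_coef p) (Rpower p x)) ->
  (s = 0%nat -> B = 0) ->
  (forall N, cpow (s + a + b) s N <= cpow (s + a) (s + b) N) ->
  completely_monotonic (fun x => F (S (s + a + b)) (S (s + a)) (S (s + b)) (S s) x q c) 0 p_infty.
Proof.
  intros hp hc0 hc1 h hB hcp. pose proof (Rpower_lt_1 p c hp hc0) as hy.
  set (D := fun j => delta_coef p c j).
  assert (hD : forall j, Rbar_le 1 (CV_radius (D j)))
    by (intros j; apply CV_radius_delta_coef; assumption).
  assert (hln : ln p < 0) by (rewrite <- ln_1; apply ln_increasing; lra).
  apply (completely_monotonic_PSeries_Rpower _
    (PS_minus (PS_mult (D (s + a)%nat) (D (s + b)%nat)) (PS_mult (D (s + a + b)%nat) (D s))) p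
    ((- ln p) ^ (S (s + a) + S (s + b)) * INR (fact (s + a)) * INR (fact (s + b)) / (c * c))).
  - apply CV_radius_ge_1_minus; apply CV_radius_ge_1_mult; apply hD.
  - exact hp.
  - apply Rmult_le_pos; [|left; apply Rinv_0_lt_compat; nra].
    apply Rmult_le_pos; [apply Rmult_le_pos|]; try (left; apply INR_fact_lt_0).
    apply pow_le; lra.
  - intros N. apply Rge_le, (Rge_minus (PS_mult (D (s + a)%nat) (D (s + b)%nat) N)
      (PS_mult (D (s + a + b)%nat) (D s) N)), Rle_ge.
    (* Coefficients of [PS_mult] are convolutions by definition, so the nonnegativity of [A_N] is
       this comparison. *)
    apply (conv_log_concave_ge (qratio p (Rpower p c)) a b s N).
    + apply qratio_0.
    + intros k; apply qratio_pos; assumption.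
    + intros k; apply qratio_log_concave; try lra.
      (* Log-concavity requires [p <= p^c], which holds since [c < 1] and [ln p < 0]. *)
      rewrite <- (Rpower_1 p) at 1 by lra. unfold Rpower.
      destruct (Rle_lt_or_eq_dec (1 * ln p) (c * ln p)) as [hlt|heq]; [nra| |].
      * left; apply exp_increasing, hlt.
      * right; f_equal; exact heq.
    + apply hcp.
  - intros x hx. unfold F, alpha.
    rewrite !Nat.sub_succ, !Nat.sub_0_r.
    rewrite !(Delta_qpolygamma q p A B c hp hc0 h) by (exact hx || (intros; apply hB; lia)).
    rewrite PSeries_minus, !PSeries_mult
      by (try apply CV_radius_inside; apply Rpower_inside; auto using CV_radius_ge_1_mult).
    fold (D (s + a)%nat) (D (s + b)%nat) (D (s + a + b)%nat) (D s).
    replace (- ln p) with (-1 * ln p) by ring.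
    replace (S (s + a + b) + S s)%nat with (S (s + a) + S (s + b))%nat by lia.
    rewrite Rpow_mult_distr.
    (* The relation [r + s = m + n] equates the powers of [ln p], and [alpha] equates the
       factorials, so both products share one prefactor. *)
    assert (E : ln p ^ S (s + a + b) * ln p ^ S s = ln p ^ S (s + a) * ln p ^ S (s + b))
      by (rewrite <- !pow_add; f_equal; lia).
    rewrite (pow_add (ln p)).
    transitivity ((-1) ^ (S (s + a) + S (s + b)) * INR (fact (s + a)) * INR (fact (s + b)) / (c * c)
      * (ln p ^ S (s + a) * ln p ^ S (s + b)
           * (PSeries (D (s + a)%nat) (Rpower p x) * PSeries (D (s + b)%nat) (Rpower p x))
         - ln p ^ S (s + a + b) * ln p ^ S s
           * (PSeries (D (s + a + b)%nat) (Rpower p x) * PSeries (D s) (Rpower p x)))).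
    + field. repeat split; try apply INR_fact_neq_0; lra.
    + rewrite E. unfold Rdiv. ring.
Qed.

Theorem theorem1p2 (q c : R) (hq : 0 < q) (hq1 : q <> 1) (hc0 : 0 < c) (hc1 : c < 1)
    (r m n s : nat) (hs : (1 <= s)%nat) (hns : (s <= n)%nat) (hmn : (n <= m)%nat)
    (hrm : (m <= r)%nat) (hsum : (r + s = m + n)%nat) :
  (s = 1%nat -> q < 1 ->
     completely_monotonic (fun x => F r m n s x q c) 0 p_infty) /\
  (s = 2%nat ->
     completely_monotonic (fun x => F r m n s x q c) 0 p_infty) /\
  (s = 3%nat -> n = 4%nat ->
     completely_monotonic (fun x => F r m n s x q c) 0 p_infty).
Proof.
  destruct (qpsi_PSeries q hq hq1) as (p & A & B & hp & hB & hpsi).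
  (* Shifting by one turns the orders into exponents; [a = m - s] and [b = n - s] then encode the
     ordering and [r + s = m + n]. *)
  assert (E : exists a b t, s = S t /\ n = S (t + b) /\ m = S (t + a) /\ r = S (t + a + b)).
  { exists (m - s)%nat, (n - s)%nat, (s - 1)%nat. lia. }
  destruct E as (a & b & t & -> & -> & -> & ->).
  assert (main : (t = 0%nat -> B = 0) ->
    (forall N, cpow (t + a + b) t N <= cpow (t + a) (t + b) N) ->
    completely_monotonic
      (fun x => F (S (t + a + b)) (S (t + a)) (S (t + b)) (S t) x q c) 0 p_infty)
    by (apply (F_completely_monotonic q c p A B); assumption).
  split; [|split]; intros ht.
  (* For [s = 1] the difference quotient of [qpsi] itself may appear, and [q < 1] supplies [B = 0].
     In the other two cases the condition on [B] is vacuous. *)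
  - intros hlt. injection ht as ->. apply main; [auto|].
    intros N. apply cpow_ge_k0.
  - injection ht as ->. apply main; [discriminate|].
    intros N. apply cpow_ge_k1. lia.
  - intros hn. injection ht as ->. assert (b = 1%nat) as -> by lia.
    apply main; [discriminate|]. intros N.
    replace (2 + a + 1)%nat with (S (2 + a)) by lia. apply cpow_3_ge_2. lia.
Qed.
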